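(* Let $n\in\mathbb{N}$. Suppose there exists an eigenfunction of $U_n$ of the form $$f(x)=\sum_{k=0}^\infty\frac{(a_1)_k(a_2)_k\cdots(a_p)_k}{(b_1)_k(b_2)_k\cdots(b_{q+1})_k}x^k$$ (with $b_{q+1}=1$) corresponding to the eigenvalue $\lambda$. Then $\lambda=1$, $p=q+1$ and $a_i=b_i$ for all $i$. Therefore $f(x)=\frac{1}{1-x}$.
   Context: For $n\in\mathbb{N}$ the operator $U_n$ acts on formal power series with complex coefficients by $U_n\left(\sum_{k\ge0}c_kx^k\right)=\sum_{k\ge0}c_{nk}x^k$; an eigenfunction with eigenvalue $\lambda$ is a nonzero $f$ with $U_nf=\lambda f$. The ascending factorial is $(c)_k=c(c+1)\cdots(c+k-1)$, $(c)_0=1$. The parameters $a_i,b_i$ are nonzero complex numbers with $-b_i\notin\mathbb{N}$.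
   Formalization: The case n = 1 is excluded, since U_1 is the identity and e.g. e^x (p = q = 0) is then an eigenfunction with eigenvalue 1; and ''a_i = b_i for all i'' is stated up to reordering the parameters, as the series is symmetric in them. *)

(* Defs.v *)
From HB Require Import structures.
From mathcomp Require Import all_boot all_order all_algebra.
From mathcomp Require Import reals.
From mathcomp Require Import complex.

Set Implicit Arguments.
Unset Strict Implicit.
Unset Printing Implicit Defensive.

Import Order.TTheory GRing.Theory Num.Theory.
Local Open Scope ring_scope.

(* A formal power series is its coefficient sequence: [f k] is the coefficient
   of x^k. Equality of series is equality of all coefficients ([=1]). *)
Definition fps (K : Type) := nat -> K.

Section FormalPowerSeries.
Variable K : fieldType.

Definition fps_of_poly (p : {poly K}) : fps K := fun k => p`_k.

Definition fps_mul (f g : fps K) : fps K :=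
  fun k => \sum_(i < k.+1) f i * g (k - i)%N.

Definition fps_scale (c : K) (f : fps K) : fps K := fun k => c * f k.

(* [f = 1 / g] as formal power series: [f] is the multiplicative inverse of
   [g] in K[[x]]. *)
Definition fps_is_inverse (f g : fps K) : Prop :=
  fps_mul g f =1 fps_of_poly 1.

Definition U (n : nat) (f : fps K) : fps K := fun k => f (n * k)%N.

Definition eigenfunction (n : nat) (lambda : K) (f : fps K) : Prop :=
  ~ (f =1 fps_of_poly 0) /\ U n f =1 fps_scale lambda f.

Definition ascending_factorial (c : K) (k : nat) : K :=
  \prod_(j < k) (c + j%:R).

Definition hypergeometric (p q : nat) (a : 'I_p -> K) (b : 'I_q.+1 -> K) :
    fps K :=
  fun k => (\prod_(i < p) ascending_factorial (a i) k) /
           (\prod_(i < q.+1) ascending_factorial (b i) k).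

End FormalPowerSeries.

(* Main.v *)
Require Import Defs.
From HB Require Import structures.
From mathcomp Require Import all_boot all_order all_algebra.
From mathcomp Require Import reals.
From mathcomp Require Import complex.
From mathcomp Require Import perm ring.

Set Implicit Arguments.
Unset Strict Implicit.
Unset Printing Implicit Defensive.

Import Order.TTheory GRing.Theory Num.Theory.
Local Open Scope ring_scope.

(** Write c_k for the coefficients of the series, and let A(X) and B(X) be the
    products of the X + a_i and of the X + b_i, so that
    c_{k+1} B(k) = c_k A(k).  Since c_0 = 1, the eigenvalue is 1, and c_{nk} = c_k.
    No c_k vanishes: one zero coefficient would make all later ones zero, among
    them some c_{n^s}, but c_{n^s} = c_1 and c_1 <> 0 because no a_i is 0.

    Comparing c_{k+1} / c_k with c_{n(k+1)} / c_{nk} then gives, at every natural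
    number X = k and hence as polynomials,
      A(X) prod_{j<n} B(n X + j) = B(X) prod_{j<n} A(n X + j).
    By unique factorization this is an equality of multisets
    ([perm_eq_of_prod_natr]).  If D(x) is the multiplicity of x among the a_i
    minus its multiplicity among the b_i, that equality says
      D(x) = sum_{j<n} D(n x - j).
    Moreover D(0) = 0, because no parameter is 0.  The heart of the proof is that
    such a finitely supported D is zero ([shift_invariant_eq0]).  Read from left to right, the relation says
    that a point x of the support leads to a point n x - j of the support.
    This multiplies the imaginary part by n, and lowers negative reals, so
    finiteness forces the support into the positive reals.  Read from right to
    left at x / n, it gives D(x / n) = D(x) + sum_{0<j<n} D(x - j), so a positive
    x in the support always yields a smaller point of it, x / n or some x - j:
    the support is empty.

    Hence the a_i are a permutation of the b_i, every c_k is 1, and the series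
    is the geometric one. *)

(** * Finitely supported functions invariant under x -> n x - j *)

(** Each step of the ascent leaves strictly fewer elements of [s] above the
    current point.  The order may be partial, so that complex numbers can serve
    as heights. *)
Lemma no_finite_ascent (T : eqType) d (V : porderType d) (h : T -> V)
    (s : seq T) (P : pred T) :
  (forall x, P x -> x \in s) ->
  (forall x, P x -> exists2 y, P y & (h x < h y)%O) ->
  forall x, ~~ P x.
Proof.
move=> Ps ascent.
suff desc m x : P x -> (count (fun y => h x < h y)%O s < m)%N -> False.
  by move=> x; apply/negP => /desc/(_ (ltnSn _)).
elim: m x => [|m IH] x // Px; rewrite ltnS => le_m.
have [y Py lt_xy] := ascent x Px.
apply: (IH y Py); apply: leq_trans le_m.
rewrite -(size_filter (fun z => h x < h z)%O) -(count_predC (pred1 y)).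
have ys : y \in [seq z <- s | (h x < h z)%O] by rewrite mem_filter lt_xy Ps.
rewrite -add1n; apply: leq_add; first by rewrite -has_count has_pred1.
rewrite count_filter; apply: sub_count => z /= lt_yz.
rewrite (lt_trans lt_xy lt_yz) andbT.
by apply: contraTneq lt_yz => ->; rewrite ltxx.
Qed.

(** An endless walk inside the support contradicts [no_finite_ascent] as soon as
    some quantity increases strictly along it: first |Im x|, which makes the
    support real, then - x on the negative reals, and finally - x on the
    positive ones. *)
Lemma shift_invariant_eq0 (C : numClosedFieldType) (V : nmodType) n
    (D : C -> V) (s : seq C) :
  (1 < n)%N ->
  D 0 = 0 ->
  (forall x, D x != 0 -> x \in s) ->
  (forall x, D x = \sum_(j < n) D (n%:R * x - j%:R)) ->
  forall x, D x = 0.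
Proof.
move=> n1 D0 Ds Dinv.
have n_gt0 : 0 < n%:R :> C by rewrite ltr0n ltnW.
have n_gt1 : 1 < n%:R :> C by rewrite ltr1n.
have step x : D x != 0 -> exists j : 'I_n, D (n%:R * x - j%:R) != 0.
  move=> Dx; apply/existsP; apply: contraNT Dx; rewrite negb_exists => /forallP Dj0.
  by rewrite Dinv big1 // => j _; apply/eqP; move: (Dj0 j); rewrite negbK.
have Dreal x : D x != 0 -> x \is Num.real.
  move=> Dx; apply/Creal_ImP/eqP.
  suff: ~~ ((D x != 0) && ('Im x != 0)) by rewrite Dx negbK.
  move: x {Dx}; apply: (@no_finite_ascent C _ C (fun z => `|'Im z|) s) => x.
    by case/andP => /Ds.
  case/andP => Dx Imx.
  have [j Dj] := step x Dx.
  have Imj : 'Im (n%:R * x - j%:R) = n%:R * 'Im x.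
    by rewrite raddfB /= ImMl ?realn // (Creal_ImP _ (realn _ _)) subr0.
  exists (n%:R * x - j%:R); rewrite Imj.
    by rewrite Dj mulf_neq0 // gt_eqF.
  by rewrite normrM normr_nat ltr_pMl ?normr_gt0.
have Dge0 x : D x != 0 -> 0 <= x.
  move=> Dx; rewrite real_leNgt ?real0 ?Dreal //.
  suff: ~~ ((D x != 0) && (x < 0)) by rewrite Dx.
  move: x {Dx}; apply: (@no_finite_ascent C _ C -%R s) => x.
    by case/andP => /Ds.
  case/andP => Dx x_lt0.
  have [j Dj] := step x Dx.
  have lt_x : n%:R * x - j%:R < x.
    by rewrite ltrBlDr ltr_wpDr ?ler0n // gtr_nMl.
  by exists (n%:R * x - j%:R); rewrite ?ltrN2 // Dj (lt_trans lt_x).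
move=> x; apply/eqP; rewrite -[_ == _]negbK; move: x.
apply: (@no_finite_ascent C _ C -%R s) => x Dx; first exact: Ds.
have x_gt0 : 0 < x.
  by rewrite lt_def Dge0 // andbT; apply: contraNneq Dx => ->; rewrite D0.
(* Either some x - j with 0 < j < n is a smaller point of the support, or
   D (x / n) reduces to its j = 0 term, which is D x. *)
have [/existsP[j /andP[j_gt0 Dj]]|] :=
    boolP [exists j : 'I_n, (0 < j)%N && (D (x - j%:R) != 0)].
  by exists (x - j%:R) => //; rewrite ltrN2 ltrBlDr ltrDl ltr0n.
rewrite negb_exists => /forallP Dj0.
exists (x / n%:R); last by rewrite ltrN2 ltr_pdivrMr // ltr_pMr.
rewrite Dinv (mulrC n%:R) divfK ?gt_eqF //.
rewrite (bigD1 (Ordinal (ltnW n1))) //= subr0 big1 ?addr0 // => j j_neq0.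
apply/eqP; move: (Dj0 j); rewrite negb_and negbK lt0n => /orP[|//].
by rewrite negbK => /eqP j0; case/eqP: j_neq0; apply: val_inj.
Qed.

(** * Products of linear factors and multisets of parameters *)

(** The two products are values of polynomials at infinitely many points, so
    the polynomials agree; their leading coefficients then match, and unique
    factorization applies.  The constants [c] and [d] absorb the powers of n
    coming from the factors n X + j + z. *)
Lemma perm_eq_of_prod_natr (F : numFieldType) (s t : seq F) (c d : F) :
  c != 0 ->
  (forall k : nat, c * \prod_(z <- s) (k%:R + z) =
                   d * \prod_(z <- t) (k%:R + z)) ->
  perm_eq s t.
Proof.
move=> c0 eq_st.
pose P (r : seq F) : {poly F} := \prod_(z <- map -%R r) ('X - z%:P).
have hornerP r k : (P r).[k%:R] = \prod_(z <- r) (k%:R + z).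
  rewrite /P big_map horner_prod; apply: eq_bigr => z _.
  by rewrite !hornerE opprK.
have eqP : c *: P s = d *: P t.
  apply/eqP; rewrite -subr_eq0; apply/eqP.
  set Q := _ - _.
  apply: (@roots_geq_poly_eq0 _ _ [seq k%:R | k <- iota 0 (size Q)]).
  - apply/allP => _ /mapP[k _ ->]; apply/rootP.
    by rewrite /Q !hornerE !hornerP eq_st subrr.
  - by rewrite map_inj_uniq ?iota_uniq // => i j /eqP; rewrite eqr_nat => /eqP.
  - by rewrite size_map size_iota.
have monicP r : lead_coef (P r) = 1.
  exact/monicP/monic_prod_XsubC.
have ecd : c = d.
  by have := congr1 lead_coef eqP; rewrite !lead_coefZ !monicP !mulr1.
apply: (perm_map_inj (@oppr_inj F)); apply/prod_XsubC_eq/(scalerI c0).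
by rewrite [LHS]eqP ecd.
Qed.

(** The multiset of the w such that X + w divides some n X + j + z with z in
    [s] and j < n. *)
Definition rescaled_shifts (F : fieldType) (n : nat) (s : seq F) : seq F :=
  [seq (z + j%:R) / n%:R | z <- s, j <- iota 0 n].

Lemma prod_rescaled_shifts (F : numFieldType) n (s : seq F) (x : F) :
  (0 < n)%N ->
  \prod_(z <- s) \prod_(j < n) (n%:R * x + j%:R + z) =
  n%:R ^+ (size s * n) * \prod_(w <- rescaled_shifts n s) (x + w).
Proof.
move=> n0; have nN0 : n%:R != 0 :> F by rewrite pnatr_eq0 -lt0n.
rewrite /rescaled_shifts big_allpairs_dep.
elim: s => [|z s IH]; first by rewrite !big_nil mul0n expr0 mulr1.
rewrite !big_cons IH mulSn exprD.
rewrite mulrACA; congr (_ * _).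
rewrite -[n in iota 0 n]subn0 -/(index_iota 0 n) big_mkord.
rewrite -[X in _ ^+ X]card_ord -prodr_const -big_split /=.
by apply: eq_bigr => j _; field.
Qed.

Lemma count_rescaled_shifts (F : numFieldType) n (s : seq F) (x : F) :
  (0 < n)%N ->
  count_mem x (rescaled_shifts n s) =
  (\sum_(j < n) count_mem (n%:R * x - j%:R)%R s)%N.
Proof.
move=> n0; have nN0 : n%:R != 0 :> F by rewrite pnatr_eq0 -lt0n.
rewrite /rescaled_shifts.
elim: s => [|z s IH] /=; first by rewrite big1.
rewrite count_cat IH big_split /=; congr (_ + _)%N.
rewrite count_map -sum1_count -[n in iota 0 n]subn0 -/(index_iota 0 n) big_mkord.
rewrite big_mkcond /=; apply: eq_bigr => j _.
have -> : ((z + j%:R) / n%:R == x) = (z == n%:R * x - j%:R).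
  by rewrite (can2_eq (divfK nN0) (mulfK nN0)) [RHS]eq_sym subr_eq (mulrC n%:R) eq_sym.
by case: ifP.
Qed.

(** The difference of the two multiplicity functions satisfies the hypotheses of
    [shift_invariant_eq0]. *)
Lemma perm_eq_of_rescaled_shifts (C : numClosedFieldType) n (s t : seq C) :
  (1 < n)%N -> 0 \notin s -> 0 \notin t ->
  perm_eq (s ++ rescaled_shifts n t) (t ++ rescaled_shifts n s) ->
  perm_eq s t.
Proof.
move=> n1 s0 t0 /seq.permP eq_st; have n0 := ltnW n1.
pose D x : int := (count_mem x s)%:R - (count_mem x t)%:R.
suff D_eq0 x : D x = 0.
  by apply/allP => x _; have /eqP := D_eq0 x; rewrite subr_eq0 eqr_nat.
apply: (@shift_invariant_eq0 C _ n D (s ++ t)) => // {x} [|x|x].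
- by rewrite /D (count_memPn s0) (count_memPn t0).
- rewrite mem_cat; apply: contraNT; rewrite negb_or => /andP[xs xt].
  by rewrite /D (count_memPn xs) (count_memPn xt).
rewrite /D sumrB -!natr_sum.
have := eq_st (pred1 x); rewrite !count_cat !count_rescaled_shifts // => eq_x.
by apply/eqP; rewrite subr_eq addrAC eq_sym subr_eq -!natrD eqr_nat addnC eq_x addnC.
Qed.

(** * Coefficients of a hypergeometric eigenfunction *)

Section Eigenfunction.

Variables (C : numClosedFieldType) (p q : nat).
Variables (a : 'I_p -> C) (b : 'I_q.+1 -> C).
Hypothesis hbN : forall i (m : nat), - b i <> m%:R.

Let c := hypergeometric a b.

Lemma hypergeometric0 : c 0%N = 1.
Proof.
rewrite /c /hypergeometric !big1 ?divr1 // => i _;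
  by rewrite /ascending_factorial big_ord0.
Qed.

Lemma denominator_neq0 i m : m%:R + b i != 0.
Proof. by rewrite addr_eq0 eq_sym; apply/eqP/hbN. Qed.

Lemma hypergeometricS k :
  c k.+1 * \prod_i (k%:R + b i) = c k * \prod_i (k%:R + a i).
Proof.
have S (r : nat) (z : 'I_r -> C) :
    \prod_i ascending_factorial (z i) k.+1 =
    \prod_i ascending_factorial (z i) k * \prod_i (k%:R + z i).
  rewrite -big_split /=; apply: eq_bigr => i _.
  by rewrite /ascending_factorial big_ord_recr /= [_ + k%:R]addrC.
have b0 : \prod_i (k%:R + b i) != 0.
  by apply/prodf_neq0 => i _; apply: denominator_neq0.
have b1 : \prod_i ascending_factorial (b i) k != 0.
  apply/prodf_neq0 => i _; apply/prodf_neq0 => j _.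
  by rewrite addrC denominator_neq0.
by rewrite /c /hypergeometric !S; field; rewrite b0 b1.
Qed.

Lemma hypergeometric_add k m :
  c (k + m)%N * \prod_(j < m) \prod_i ((k + j)%:R + b i) =
  c k * \prod_(j < m) \prod_i ((k + j)%:R + a i).
Proof.
elim: m => [|m IH]; first by rewrite !big_ord0 addn0.
rewrite !(big_ord_recr m) /= [RHS]mulrA -IH addnS.
by rewrite [LHS]mulrCA hypergeometricS; ring.
Qed.

Variables (n : nat) (lambda : C).
Hypothesis n_gt1 : (1 < n)%N.
Hypothesis ha : forall i, a i <> 0.
Hypothesis hb : forall i, b i <> 0.
Hypothesis hf : U n c =1 fps_scale lambda c.

Lemma eigenvalue1 : lambda = 1.
Proof.
by have := hf 0; rewrite /U /fps_scale muln0 hypergeometric0 mulr1.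
Qed.

Lemma coef_invariant k : c (n * k)%N = c k.
Proof. by have := hf k; rewrite /U /fps_scale eigenvalue1 mul1r. Qed.

(** A zero coefficient propagates upwards by the recurrence, while the
    coefficients of index n ^ s all equal the nonzero first one. *)
Lemma hypergeometric_neq0 k : c k != 0.
Proof.
have c1 : c 1%N != 0.
  have := hypergeometricS 0; rewrite hypergeometric0 mul1r => c1E.
  apply: contra_neq (_ : \prod_i (0%:R + a i) != 0) => [c10|].
    by rewrite -c1E c10 mul0r.
  by apply/prodf_neq0 => i _; rewrite add0r; apply/eqP.
have cpow s : c (n ^ s)%N = c 1%N.
  by elim: s => // s IH; rewrite expnS coef_invariant.
have vanish m : c k = 0 -> c (k + m)%N = 0.
  move=> ck0; elim: m => [|m IH]; first by rewrite addn0.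
  have /eqP := hypergeometricS (k + m)%N; rewrite IH mul0r mulf_eq0 addnS.
  case/orP => [/eqP//|]; apply: contraTeq => _.
  by apply/prodf_neq0 => i _; apply: denominator_neq0.
apply: contra_neq c1 => /(vanish (n ^ k - k)%N).
by rewrite subnKC ?cpow // ltnW // ltn_expl.
Qed.

(** The recurrence iterated n times from n k and the recurrence at k both relate
    c_k to c_{k+1}, by invariance; cancelling c_k gives the polynomial
    identity between the two multisets of linear factors. *)
Lemma parameters_perm_eq : perm_eq (codom a) (codom b).
Proof.
have n0 := ltnW n_gt1.
apply: (@perm_eq_of_rescaled_shifts C n) => //.
- by apply/codomP => -[i /esym]; apply: ha.
- by apply/codomP => -[i /esym]; apply: hb.
pose d m : C := n%:R ^+ (m * n).
have d0 m : d m != 0 by rewrite expf_neq0 // pnatr_eq0 -lt0n.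
apply: (perm_eq_of_prod_natr (d0 (size (codom b))) (d := d (size (codom a)))) => k.
rewrite !big_cat /= [LHS]mulrCA [RHS]mulrCA -!prod_rescaled_shifts //.
rewrite !big_image /=.
have stepn : c k.+1 * \prod_(j < n) \prod_i ((n * k + j)%:R + b i) =
             c k * \prod_(j < n) \prod_i ((n * k + j)%:R + a i).
  by rewrite -(coef_invariant k) -hypergeometric_add [(n * k + n)%N]addnC -mulnS coef_invariant.
have shiftE (r : nat) (z : 'I_r -> C) :
    \prod_i \prod_(j < n) (n%:R * k%:R + j%:R + z i) =
    \prod_(j < n) \prod_i ((n * k + j)%:R + z i).
  by rewrite exchange_big; do 2 ![apply: eq_bigr => ? _]; rewrite natrD natrM.
rewrite !shiftE; apply: (mulfI (hypergeometric_neq0 k)).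
rewrite mulrA -hypergeometricS mulrAC stepn; ring.
Qed.

End Eigenfunction.

(** * Conclusion *)

Lemma bijection_of_perm_eq_codom (T : eqType) (p q : nat)
    (a : 'I_p -> T) (b : 'I_q -> T) :
  perm_eq (codom a) (codom b) ->
  exists2 sigma : 'I_p -> 'I_q, bijective sigma & forall i, a i = b (sigma i).
Proof.
move=> eq_ab; have pq : p = q.
  by have := perm_size eq_ab; rewrite !size_codom !card_ord.
case: q / pq b eq_ab => b eq_ab.
have codomE (f : 'I_p -> T) : codom f = [tuple f i | i < p].
  by [].
move: eq_ab; rewrite !codomE => /tuple_permP[s /val_inj eq_ab].
exists s => [|i]; first exact/injF_bij/perm_inj.
by have := congr1 (fun t => tnth t i) eq_ab; rewrite !tnth_mktuple.
Qed.

Theorem theorem6p6 (R : realType) (n : nat) (hn : (0 < n)%N) (hn1 : n <> 1%N)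
    (p q : nat) (a : 'I_p -> R[i]) (b : 'I_q.+1 -> R[i]) (lambda : R[i])
    (ha : forall i, a i <> 0)
    (hb : forall i, b i <> 0)
    (hbN : forall i (m : nat), - b i <> m%:R)
    (hb_last : b ord_max = 1)
    (hf : eigenfunction n lambda (hypergeometric a b)) :
  [/\ lambda = 1,
      p = q.+1,
      exists sigma : 'I_p -> 'I_q.+1,
        bijective sigma /\ forall i, a i = b (sigma i)
    & fps_is_inverse (hypergeometric a b) (fps_of_poly (1 - 'X))].
Proof.
have n_gt1 : (1 < n)%N by rewrite ltn_neqAle hn andbT eq_sym; apply/eqP.
case: hf => _ hU.
have eq_ab := parameters_perm_eq hbN n_gt1 ha hb hU.
have [sigma sigma_bij ab] := bijection_of_perm_eq_codom eq_ab.
split.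
- exact: eigenvalue1 hU.
- by have := perm_size eq_ab; rewrite !size_codom !card_ord.
- by exists sigma.
have f1 k : hypergeometric a b k = 1.
  rewrite /hypergeometric (reindex sigma) /=; last exact: onW_bij.
  under eq_bigr => i _ do rewrite ab.
  rewrite divff //; apply/prodf_neq0 => i _; apply/prodf_neq0 => j _.
  by rewrite addrC denominator_neq0.
move=> k; rewrite /fps_mul /fps_of_poly.
under eq_bigr => i _ do rewrite f1 mulr1 coefB coef1 coefX.
case: k => [|k]; first by rewrite big_ord1 coef1 subr0.
by rewrite !big_ord_recl /= big1 ?coef1 //= => *; rewrite ?subrr //; ring.
Qed.
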